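(* Let $m, t, a$ and $r\ge 4$ be positive integers satisfying $m=\binom{t}{r}-a$, where $12\le a\le t-r+1$. Let $G=([t],E)$ be a left-compressed $r$-graph with $m$ edges. If $|E(G)\triangle E(C_{r,m})|\le 4$, then $\lambda(G)\le\lambda(C_{r,m})$.
   Context: Notation: $[n]=\{1,\ldots,n\}$; for a set $V$, $V^{(r)}$ is the family of all $r$-element subsets of $V$; $\mathbb{N}=\{1,2,3,\ldots\}$; $A\triangle B=(A\setminus B)\cup(B\setminus A)$. An $r$-graph $G=(V,E)$ consists of a vertex set $V$ and an edge set $E=E(G)\subseteq V^{(r)}$. Graph-Lagrangian: for an $r$-graph $G$ with vertex set $[n]$ and edge set $E$, and $\vec{x}=(x_1,\ldots,x_n)\in\mathbb{R}^n$, put $\lambda(G,\vec{x})=\sum_{\{i_1,\ldots,i_r\}\in E}x_{i_1}x_{i_2}\cdots x_{i_r}$. The graph-Lagrangian of $G$ is $\lambda(G)=\max\{\lambda(G,\vec{x}) : x_j\ge 0 \text{ for all } j,\ \sum_{j=1}^n x_j=1\}$. Colex ordering: for distinct $A,B\in\mathbb{N}^{(r)}$, $A$ is less than $B$ in the colex ordering if $\max(A\triangle B)\in B$. $C_{r,m}$ denotes the $r$-graph whose edges are the first $m$ sets in the colex ordering of $\mathbb{N}^{(r)}$ (for $m\le\binom{t}{r}$ it may be regarded as an $r$-graph on $[t]$). Left-compressed: an $r$-graph $G=([n],E)$ is left-compressed if, whenever $\{j_1<j_2<\cdots<j_r\}\in E$ and $\{i_1<i_2<\cdots<i_r\}\in[n]^{(r)}$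 satisfies $i_p\le j_p$ for every $1\le p\le r$, then $\{i_1,\ldots,i_r\}\in E$. *)

(* Defs.v *)
From HB Require Import structures.
From mathcomp Require Import all_boot all_order all_algebra.
From mathcomp Require Import all_classical all_reals all_analysis.
Set Implicit Arguments.
Unset Strict Implicit.
Unset Printing Implicit Defensive.
Import Order.TTheory GRing.Theory Num.Theory.
Import numFieldNormedType.Exports.
Local Open Scope ring_scope.

(* The vertex set [n] = {1, ..., n} is represented by 'I_n = {0, ..., n-1},
   through the order isomorphism i |-> i - 1. *)

Definition is_rgraph (n r : nat) (E : {set {set 'I_n}}) : Prop :=
  forall A, A \in E -> #|A| = r.

Definition symdiff (T : finType) (A B : {set T}) : {set T} :=
  (A :\: B) :|: (B :\: A).

Definition lagr_poly (R : realType) (n : nat) (E : {set {set 'I_n}})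
    (x : 'rV[R]_n) : R :=
  \sum_(A in E) \prod_(i in A) x 0 i.

Definition simplex (R : realType) (n : nat) : set 'rV[R]_n :=
  [set x | (forall j, 0 <= x 0 j) /\ \sum_j x 0 j = 1]%classic.

(* For 0 < n this supremum is a maximum, see [lagrangian_max]. *)
Definition lagrangian (R : realType) (n : nat) (E : {set {set 'I_n}}) : R :=
  sup [set lagr_poly E x | x in @simplex R n]%classic.

(* The largest element i of the symmetric difference exists and lies in B. *)
Definition colex_lt (n : nat) (A B : {set 'I_n}) : bool :=
  [exists i in symdiff A B,
    [forall j in symdiff A B, (j <= i)%N] && (i \in B)].

(* The first m sets of [n]^(r), i.e. those with fewer than m predecessors in
   [n]^(r).  When m <= 'C(n, r) they are the first m sets of NN^(r): replacing
   n by a larger n' gives the same sets, see [colex_graph_widen]. *)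
Definition colex_graph (n r m : nat) : {set {set 'I_n}} :=
  [set A : {set 'I_n} | (#|A| == r) &&
    (#|[set B : {set 'I_n} | (#|B| == r) && colex_lt B A]| < m)%N].

(* The r-subsets {j_1 < ... < j_r} of [n] are the images of the increasing
   maps j : 'I_r -> 'I_n. *)
Definition left_compressed (n r : nat) (E : {set {set 'I_n}}) : Prop :=
  forall i j : 'I_r -> 'I_n,
    {homo i : p q / (p < q)%N} -> {homo j : p q / (p < q)%N} ->
    (forall p, (i p <= j p)%N) ->
    [set j p | p : 'I_r] \in E -> [set i p | p : 'I_r] \in E.

Lemma simplex_neq0 (R : realType) n : (0 < n)%N -> (@simplex R n !=set0)%classic.
Proof.
case: n => // n _; exists (delta_mx 0 0); split=> [j|].
  by rewrite mxE; case: (_ && _).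
rewrite (bigD1 ord0) //= big1 ?addr0 => [|j /negPf nj]; rewrite mxE ?eqxx //.
by rewrite nj andbF.
Qed.

Lemma simplex_compact (R : realType) n : compact (@simplex R n).
Proof.
apply: bounded_closed_compact.
  exists 1; split; first exact: num_real.
  move=> M M1 x [x0 x1]; apply: (le_trans _ (ltW M1)).
  rewrite [leLHS]mx_normrE; apply: bigmax_le => // -[i j] _ /=.
  rewrite (ord1 i) ger0_norm // -x1 (bigD1 j) //= lerDl.
  by apply: sumr_ge0.
have -> : @simplex R n =
    ((\bigcap_(j in [set: 'I_n]) [set x : 'rV[R]_n | 0 <= x 0%R j]) `&`
    (fun x : 'rV[R]_n => \sum_j x 0%R j) @^-1` [set 1])%classic.
  by apply/seteqP; split=> x [h1 h2]; split=> // j *; apply: h1.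
apply: closedI.
  apply: closed_bigI => j _.
  apply: (@preimage_closed _ _ (fun x : 'rV[R]_n => x 0 j) [set y | 0 <= y]%classic).
    by move=> x _; exact: coord_continuous.
  exact: closed_ge.
apply: preimage_closed; last exact: closed_eq.
move=> x _; move: x; apply: continuous_big; first exact: add_continuous.
by move=> j _; exact: coord_continuous.
Qed.

Lemma lagr_poly_continuous (R : realType) n (E : {set {set 'I_n}}) :
  continuous (@lagr_poly R n E).
Proof.
apply: continuous_big; first exact: add_continuous.
move=> A _; apply: continuous_big; first exact: mul_continuous.
by move=> i _; exact: coord_continuous.
Qed.

Lemma lagrangian_max (R : realType) n (E : {set {set 'I_n}}) : (0 < n)%N ->
  exists2 x : 'rV[R]_n, simplex x &
    lagr_poly E x = lagrangian R E /\
    forall y, simplex y -> lagr_poly E y <= lagr_poly E x.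
Proof.
move=> n0.
have [x sx xmax] := @EVT_max_rV R n (@lagr_poly R n E) (@simplex R n)
  (simplex_neq0 R n0) (@simplex_compact R n)
  (continuous_subspaceT (@lagr_poly_continuous R n E)).
move: sx; rewrite inE => sx.
have xub y : simplex y -> lagr_poly E y <= lagr_poly E x.
  by move=> sy; apply: xmax; rewrite inE.
exists x => //; split=> //; apply/eqP; rewrite eq_le; apply/andP; split.
  apply: ub_le_sup; last by exists x.
  by exists (lagr_poly E x) => _ [y sy <-]; exact: xub.
apply: ge_sup; first by exists (lagr_poly E x), x.
by move=> _ [y sy <-]; exact: xub.
Qed.

Lemma in_symdiff (T : finType) (A B : {set T}) x :
  (x \in symdiff A B) = (x \in A) (+) (x \in B).
Proof. by rewrite !inE; case: (x \in A); case: (x \in B). Qed.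

Lemma colex_ltP n (A B : {set 'I_n}) :
  reflect (exists i, [/\ i \in B, i \notin A &
             forall j : 'I_n, (i < j)%N -> (j \in A) = (j \in B)])
          (colex_lt A B).
Proof.
apply: (iffP existsP) => [[i /and3P[+ /forallP im iB]]|[i [iB iA im]]].
  rewrite in_symdiff iB addbT => iA; exists i; split=> // j ij.
  have /implyP := im j; rewrite in_symdiff leqNgt ij /=.
  by case: (_ \in A); case: (_ \in B) => // /(_ isT).
exists i; rewrite in_symdiff iB addbT iA /= andbT; apply/forallP => j.
apply/implyP; rewrite in_symdiff leqNgt; apply: contraL => /im ->.
by rewrite addbb.
Qed.

Lemma colex_ltxx n (A : {set 'I_n}) : colex_lt A A = false.
Proof. by case E: (colex_lt A A) => //; case/colex_ltP: E => i [->]. Qed.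

Lemma colex_lt_trans n : transitive (@colex_lt n).
Proof.
move=> B A C /colex_ltP[i [iB iA im]] /colex_ltP[j [jC jB jm]].
apply/colex_ltP; case: (ltngtP i j) => [ij|ji|/val_inj eij].
- exists j; rewrite jC im // jB; split=> // k jk.
  by rewrite im ?jm // (ltn_trans ij).
- exists i; rewrite -jm // iB iA; split=> // k ik.
  by rewrite im ?jm // (ltn_trans ji).
- by rewrite -eij iB in jB.
Qed.

Lemma colex_lt_total n (A B : {set 'I_n}) :
  A != B -> colex_lt A B || colex_lt B A.
Proof.
move=> nAB.
have [i0 i0P] : exists i, i \in symdiff A B.
  apply/existsP; apply: contraR nAB; rewrite negb_exists => /forallP h.
  apply/eqP/setP => i; have := h i; rewrite in_symdiff.
  by case: (i \in A); case: (i \in B).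
case: (@arg_maxnP _ i0 (fun i => i \in symdiff A B) (@nat_of_ord n) i0P) => i.
rewrite in_symdiff => iP im.
have h (j : 'I_n) : (i < j)%N -> (j \in A) = (j \in B).
  move=> ij; have := im j; rewrite in_symdiff /= leqNgt ij.
  by case: (j \in A); case: (j \in B) => // /(_ isT).
move: iP.
case: (boolP (i \in A)) => iA; case: (boolP (i \in B)) => iB //= _.
  by apply/orP; right; apply/colex_ltP; exists i; split=> // j /h ->.
by apply/orP; left; apply/colex_ltP; exists i; split.
Qed.

Lemma card_colex_graph n r m :
  (m <= 'C(n, r))%N -> #|colex_graph n r m| = m.
Proof.
move=> le_m.
pose D := [set A : {set 'I_n} | #|A| == r].
pose rk (A : {set 'I_n}) := #|[set B : {set 'I_n} | (#|B| == r) && colex_lt B A]|.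
have cD : #|D| = 'C(n, r) by rewrite card_draws card_ord.
have rk_mono A B : A \in D -> colex_lt A B -> (rk A < rk B)%N.
  rewrite inE => cA AB; apply: proper_card; apply/properP; split.
    by apply/fintype.subsetP => C; rewrite !inE => /andP[-> /colex_lt_trans]; apply.
  by exists A; rewrite !inE cA ?AB ?colex_ltxx.
have rk_inj : {in D &, injective rk}.
  move=> A B AD BD eAB; apply/eqP; apply: contraT => /colex_lt_total.
  by case/orP => /rk_mono; rewrite eAB ltnn => ->.
have rk_lt A : A \in D -> (rk A < 'C(n, r))%N.
  move=> AD; rewrite -cD; apply: proper_card; apply/properP; split.
    by apply/fintype.subsetP => C; rewrite !inE => /andP[].
  by exists A; rewrite // inE colex_ltxx andbF.
have u : uniq [seq rk A | A <- enum D].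
  by rewrite map_inj_in_uniq ?enum_uniq // => A B; rewrite !mem_enum; exact: rk_inj.
have sz : size (iota 0 'C(n, r)) = size [seq rk A | A <- enum D].
  by rewrite size_iota size_map -cardE cD.
have sub : {subset [seq rk A | A <- enum D] <= iota 0 'C(n, r)}.
  by move=> k /mapP[A]; rewrite mem_enum mem_iota /= add0n => /rk_lt + ->.
have [_ eqi] := uniq_min_size u sub (eq_leq sz).
have /permP pe : perm_eq [seq rk A | A <- enum D] (iota 0 'C(n, r)).
  by apply: uniq_perm; rewrite ?iota_uniq.
have -> : #|colex_graph n r m| = count (fun k => k < m)%N [seq rk A | A <- enum D].
  rewrite count_map -size_filter cardE /enum_mem -filter_predI.
  congr size; apply: eq_filter => A /=.
  by rewrite !inE andbC.
rewrite pe -(subnKC le_m) iotaD count_cat (@eq_in_count _ _ predT) => [|k].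
  rewrite count_predT size_iota (@eq_in_count _ _ pred0) ?count_pred0 ?addn0 // => k.
  by rewrite mem_iota add0n => /andP[? _]; rewrite ltnNge /= -[RHS]/(~~ true); congr negb.
by rewrite mem_iota add0n => /andP[_ ->].
Qed.

Lemma colex_graph_widen n n' r m (le_nn' : (n <= n')%N) :
  (m <= 'C(n, r))%N ->
  colex_graph n' r m =
  [set [set widen_ord le_nn' i | i in A] | A : {set 'I_n} in colex_graph n r m].
Proof.
move=> le_m; set w := fun A : {set 'I_n} => [set widen_ord le_nn' i | i in A].
have wi : injective (widen_ord le_nn') by move=> i j /(congr1 val) /= /val_inj.
have w_inj : injective w by exact: imset_inj.
have cw A : #|w A| = #|A| by rewrite card_imset.
have mw A i : (widen_ord le_nn' i \in w A) = (i \in A) by rewrite mem_imset.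
have nw A (i : 'I_n') : (n <= i)%N -> i \in w A = false.
  by move=> ni; apply/negP => /imsetP[j _ ij]; move: ni; rewrite ij /= leqNgt ltn_ord.
have ow (i : 'I_n') : (i < n)%N -> exists j, i = widen_ord le_nn' j.
  by move=> lin; exists (Ordinal lin); apply: val_inj.
have ltw A B : colex_lt (w A) (w B) = colex_lt A B.
  apply/colex_ltP/colex_ltP => -[i [iB iA im]].
    case/imsetP: (iB) => j jB eij; move: iA im; rewrite eij mw => jA im.
    by exists j; split=> // k jk; rewrite -!mw im.
  exists (widen_ord le_nn' i); rewrite !mw; split=> // k ik.
  have [/ow[l elk]|nk] := ltnP k n; last by rewrite !nw.
  by move: ik; rewrite elk !mw; apply: im.
have surj (B : {set 'I_n'}) :
    (forall i, i \in B -> (i < n)%N) -> exists A, B = w A.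
  move=> hB; exists [set i | widen_ord le_nn' i \in B]; apply/setP => i.
  have [/ow[j ->]|ni] := ltnP i n; first by rewrite mw inE.
  by rewrite nw //; apply/negP => /hB; rewrite ltnNge ni.
have big A (B : {set 'I_n'}) i0 : i0 \in B -> (n <= i0)%N -> colex_lt (w A) B.
  move=> i0B ni0; case: (@arg_maxnP _ i0 (fun i => i \in B) (@nat_of_ord n') i0B) => i iB im.
  have ni : (n <= i)%N by apply: (leq_trans ni0); exact: im.
  apply/colex_ltP; exists i; rewrite nw //; split=> // j ij.
  rewrite nw ?(leq_trans ni (ltnW ij)) //; apply/esym/negP => /im /=.
  by rewrite leqNgt ij.
have cpred A : [set B : {set 'I_n'} | (#|B| == r) && colex_lt B (w A)] =
    w @: [set B : {set 'I_n} | (#|B| == r) && colex_lt B A].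
  apply/setP => B; apply/idP/imsetP.
    rewrite inE => /andP[cB BA].
    have [i iB|C eB] := surj B; last first.
      by exists C => //; rewrite inE -cw -ltw -eB cB.
    rewrite ltnNge; apply/negP => ni; have := big A B i iB ni.
    by move/colex_lt_trans => /(_ _ BA); rewrite colex_ltxx.
  by move=> [C + ->]; rewrite !inE cw ltw.
apply/setP => B; apply/idP/imsetP.
  rewrite inE => /andP[cB ltB].
  have [i iB|C eB] := surj B; last first.
    by exists C => //; move: cB ltB; rewrite eB cw cpred card_imset // inE => -> ->.
  rewrite ltnNge; apply/negP => ni; move: ltB; rewrite ltnNge => /negP; apply.
  apply: (leq_trans le_m); rewrite -[n in 'C(n, r)]card_ord -card_draws.
  rewrite -(card_imset _ w_inj); apply: subset_leq_card.
  apply/fintype.subsetP => _ /imsetP[A + ->].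
  by rewrite !inE cw => -> /=; apply: big iB ni.
by move=> [A + ->]; rewrite !inE cw cpred card_imset.
Qed.

(* Main.v *)
(* Number the vertices 0, ..., t-1, put b = t - r + 1, T = {b, ..., t-1}.  The r-sets
   missing from C_{r,m} are a stars {i} + T.  If E <> C_{r,m}, the r-sets missing
   from E are at least a - 2 >= 10 stars, the set S = {b-2, b-1} + T - {b}, and
   possibly one of {b-3, b-1} + T - {b} and {b-2, b-1} + T - {b+1}; none contains
   the vertex 0.

   Let x be an optimal weighting of E.  If some weight vanishes, x can be moved to
   one supported off the last vertex, where all edges belong to C_{r,m}.  Otherwise
   stationarity at the vertices 0, v gives K_v (x_0 - x_v) = M_v, where M_v is the
   total weight of the missing sets through v and K_v that of the (r-1)-sets through
   v avoiding 0; also x is non-increasing, so K_v decreases with v.  For v = b+1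
   this yields x_{b+1} >= 3/8 x_0, and then M_{b-2} + M_{b-1} <= M_b because the
   many stars all contain b.  Hence (x_0 - x_{b-2}) + (x_0 - x_{b-1}) <= x_0 - x_b,
   so x_0 x_b <= x_{b-2} x_{b-1}: in weight, every set of C_{r,m} missing from E
   is at least every star in E missing from C_{r,m}. *)
Require Import Defs.
From mathcomp Require Import all_boot all_order all_algebra.
From mathcomp Require Import all_classical all_reals all_analysis.
From mathcomp Require Import perm.
From mathcomp Require Import zify ring lra.
Import mathcomp.boot.fintype mathcomp.boot.finset.
Set Implicit Arguments.
Unset Strict Implicit.
Unset Printing Implicit Defensive.
Import Order.TTheory GRing.Theory Num.Theory.
Local Open Scope ring_scope.

(** * Tails of the vertex set and left-compression *)

Definition upto {n} (k : nat) : {set 'I_n} := [set i : 'I_n | (k <= i)%N].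

Lemma card_upto n k : #|@upto n k| = (n - k)%N.
Proof.
rewrite cardsE -sum1_card.
by rewrite (eq_bigl (fun i : 'I_n => (k <= i)%N)) // -(big_geq_mkord k n xpredT (fun _ => 1%N)) sum_nat_const_nat muln1.
Qed.

Lemma increasing_enumeration n r (A : {set 'I_n}) : #|A| = r ->
  exists2 j : 'I_r -> 'I_n, {homo j : p q / (p < q)%N} &
    [set j p | p : 'I_r] = A.
Proof.
move=> cA; exists (fun p => enum_val (cast_ord (esym cA) p)); last first.
  apply/setP => i; apply/imsetP/idP => [[p _ ->]|iA]; first exact: enum_valP.
  by exists (cast_ord cA (enum_rank_in iA i)); rewrite // cast_ordK enum_rankK_in.
move=> p q pq.
have sA : sorted ltn [seq nat_of_ord i | i <- enum A].
  rewrite sorted_map; apply: sorted_filter.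
    by move=> ? ? ?; exact: ltn_trans.
  by rewrite -sorted_map -enumT val_enum_ord; exact: iota_ltn_sorted.
have n0 : 'I_n := enum_val (cast_ord (esym cA) p).
rewrite !(enum_val_nth n0) -!(nth_map n0 0%N) -?cardE ?cA //.
by apply: (sorted_ltn_nth ltn_trans 0%N sA); rewrite ?inE ?size_map -?cardE ?cA.
Qed.

(** Suppose [i p > j p] for some [p]. The tail from [i p] then contains every [i q] with [q >= p],
    but among the [j q] only some with [q > p], so it would count more of [A] than of [B]. *)
Lemma left_compressed_dominated n r (E : {set {set 'I_n}}) (A B : {set 'I_n}) :
  left_compressed r E -> #|A| = r -> #|B| = r ->
  (forall k, #|A :&: upto k| <= #|B :&: upto k|)%N -> B \in E -> A \in E.
Proof.
move=> lcE cA cB dom.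
have [i hi eA] := increasing_enumeration cA.
have [j hj eB] := increasing_enumeration cB.
rewrite -eA -eB; apply: lcE => // p; rewrite leqNgt; apply/negP => ji.
have injh (f : 'I_r -> 'I_n) : {homo f : p q / (p < q)%N} -> injective f.
  move=> hf q q' e; case: (ltngtP q q') => [/hf|/hf|/val_inj //]; by rewrite e ltnn.
have := dom (i p); apply/negP; rewrite -ltnNge.
have sB : B :&: upto (i p) \subset j @: [set q : 'I_r | (p < q)%N].
  apply/subsetP => k; rewrite !inE -eB => /andP[/imsetP[q _ ->] ipq].
  apply: imset_f; rewrite inE ltnNge; apply/negP; rewrite leq_eqVlt => /orP[/eqP/val_inj eq|/hj].
    by move: ipq; rewrite eq leqNgt ji.
  by move=> jqp; have := leq_ltn_trans ipq (ltn_trans jqp ji); rewrite ltnn.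
have sA : i @: [set q : 'I_r | (p <= q)%N] \subset A :&: upto (i p).
  apply/subsetP => _ /imsetP[q + ->]; rewrite !inE -eA imset_f //= leq_eqVlt.
  by case/orP => [/eqP/val_inj -> //|/hi/ltnW].
apply: (leq_ltn_trans (subset_leq_card sB)); apply: leq_trans (subset_leq_card sA).
rewrite !card_imset; [|exact: injh|exact: injh].
apply: proper_card; apply/properP; split; last by exists p; rewrite !inE ?leqnn ?ltnn.
by apply/subsetP => q; rewrite !inE => /ltnW.
Qed.

Lemma left_compressed_swap n r (E : {set {set 'I_n}}) (B : {set 'I_n}) (u v : 'I_n) :
  left_compressed r E -> #|v |: B| = r -> (u < v)%N -> u \notin B -> v \notin B ->
  v |: B \in E -> u |: B \in E.
Proof.
move=> lcE cB uv uB vB; apply: (left_compressed_dominated lcE _ cB) => //.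
  by rewrite -cB !cardsU1 uB vB.
move=> k; rewrite !setIUl.
have -> : [set v] :&: upto k = if (k <= v)%N then [set v] else set0.
  apply/setP => i; rewrite !inE; case: eqP => [->|ni]; case: ifP; rewrite ?inE ?eqxx //.
  by case: eqP.
have -> : [set u] :&: upto k = if (k <= u)%N then [set u] else set0.
  apply/setP => i; rewrite !inE; case: eqP => [->|ni]; case: ifP; rewrite ?inE ?eqxx //.
  by case: eqP.
case: ifP => ku; last by rewrite set0U subset_leq_card // subsetU // subxx orbT.
by rewrite (leq_trans ku (ltnW uv)) !cardsU1 !inE (negPf uB) (negPf vB).
Qed.

(* With [b = n - r + 1] and 0-based vertices, the last r-sets in colex order are
   the stars [i |: upto b], [i < b].  The r-sets that are not stars and of which
   at most two are missing from a left-compressed r-graph can only be [botS],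
   [botS1] and [botS2] below, where [c3, c2, c1, d0, d1] stand for
   [b-3, b-2, b-1, b, b+1]. *)
Definition botS n (c2 d0 : 'I_n) : {set 'I_n} := upto c2 :\ d0.
Definition botS1 n (c3 c2 d0 : 'I_n) : {set 'I_n} := upto c3 :\ d0 :\ c2.
Definition botS2 n (c2 d1 : 'I_n) : {set 'I_n} := upto c2 :\ d1.

(** * Missing sets that are not stars *)

Section NonStar.

Variables (n b r : nat) (c3 c2 c1 d0 d1 : 'I_n).
Hypothesis nbr : n.+1 = (b + r)%N.
Hypotheses (b_ge12 : (12 <= b)%N) (r_ge4 : (4 <= r)%N).
Hypotheses (c3E : c3.+3 = b) (c2E : c2.+2 = b) (c1E : c1.+1 = b).
Hypotheses (d0E : d0 = b :> nat) (d1E : d1 = b.+1 :> nat).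

Local Notation botS := (botS c2 d0).
Local Notation botS1 := (botS1 c3 c2 d0).
Local Notation botS2 := (botS2 c2 d1).

Lemma card_setI_upto (A : {set 'I_n}) k : (#|A :&: upto k| <= n - k)%N.
Proof. by rewrite -card_upto subset_leq_card ?subsetIr. Qed.

Lemma card_setI_upto_lt (A : {set 'I_n}) (e : 'I_n) k : e \notin A -> (k <= e)%N ->
  (#|A :&: upto k| <= (n - k).-1)%N.
Proof.
move=> eA ke; rewrite -(card_upto n) (cardsD1 e (upto k)) [e \in _]inE ke add1n /=.
apply/subset_leq_card/subsetP => i; rewrite !inE => /andP[iA ->].
by rewrite andbT; apply: contraNneq eA => <-.
Qed.

Lemma card_uptoD1 (e : 'I_n) k : (k <= e)%N -> #|upto k :\ e| = (n - k).-1.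
Proof. by move=> ke; rewrite -(card_upto n) (cardsD1 e (upto k)) inE ke add1n. Qed.

Lemma bot_notin (o : 'I_n) (A : {set 'I_n}) : (o < c3)%N ->
  A \in [:: botS; botS1; botS2] -> o \notin A.
Proof.
move=> oc3; rewrite !inE => /or3P[] /eqP ->; rewrite !inE !negb_and -!ltnNge.
- by apply/orP; right; lia.
- by rewrite oc3 !orbT.
- by apply/orP; right; lia.
Qed.

Lemma card_botS : #|botS| = r.
Proof. have h : (c2 <= d0)%N by lia. rewrite card_uptoD1 //; lia. Qed.

Lemma card_botS2 : #|botS2| = r.
Proof. have h : (c2 <= d1)%N by lia. rewrite card_uptoD1 //; lia. Qed.

Lemma card_botS1 : #|botS1| = r.
Proof.
have h : (c3 <= d0)%N by lia.
have := cardsD1 c2 (upto c3 :\ d0); rewrite card_uptoD1 -/botS1 //.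
have -> : c2 \in upto c3 :\ d0 by rewrite !inE -val_eqE /=; lia.
by rewrite add1n => /(congr1 predn) /= <-; lia.
Qed.

(** The tails of [botS] are as large as possible. Up to [c2] it is counted whole; for [c2 < k <= b]
    it omits only [d0], while [A] omits some vertex of [upto b] as well; beyond [b] it contains the
    full tail. *)
Lemma dominated_botS (A : {set 'I_n}) k : #|A| = r -> ~~ (upto b \subset A) ->
  (#|A :&: upto k| <= #|botS :&: upto k|)%N.
Proof.
move=> cA /subsetPn[e]; rewrite inE => be eA.
have [kc2|c2k] := leqP k c2.
  have -> : botS :&: upto k = botS by apply/setIidPl/subsetP => i; rewrite !inE; lia.
  by rewrite card_botS -cA subset_leq_card ?subsetIl.
have [kb|bk] := leqP k b.
  apply: (leq_trans (card_setI_upto_lt eA (leq_trans kb be))).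
  rewrite -(@card_uptoD1 d0) ?d0E // subset_leq_card //; apply/subsetP => i.
  rewrite !inE; lia.
apply: (leq_trans (card_setI_upto A k)).
rewrite -card_upto subset_leq_card //; apply/subsetP => i.
rewrite !inE -val_eqE /=; lia.
Qed.

Lemma dominated_botS2 (A : {set 'I_n}) k : #|A| = r -> ~~ (upto b.+1 \subset A) ->
  (#|A :&: upto k| <= #|botS2 :&: upto k|)%N.
Proof.
move=> cA /subsetPn[e]; rewrite inE => be eA.
have [kc2|c2k] := leqP k c2.
  have -> : botS2 :&: upto k = botS2 by apply/setIidPl/subsetP => i; rewrite !inE; lia.
  by rewrite card_botS2 -cA subset_leq_card ?subsetIl.
have [kb|bk] := leqP k b.+1.
  apply: (leq_trans (card_setI_upto_lt eA (leq_trans kb be))).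
  rewrite -(@card_uptoD1 d1) ?d1E // subset_leq_card //; apply/subsetP => i.
  rewrite !inE; lia.
apply: (leq_trans (card_setI_upto A k)).
rewrite -card_upto subset_leq_card //; apply/subsetP => i.
rewrite !inE -val_eqE /=; lia.
Qed.

Lemma dominated_botS1 (A : {set 'I_n}) k : #|A| = r -> d0 \notin A -> A != botS ->
  (#|A :&: upto k| <= #|botS1 :&: upto k|)%N.
Proof.
move=> cA d0A AS.
have [kc3|c3k] := leqP k c3.
  have -> : botS1 :&: upto k = botS1 by apply/setIidPl/subsetP => i; rewrite !inE; lia.
  by rewrite card_botS1 -cA subset_leq_card ?subsetIl.
have [kb|bk] := leqP k b.
  have [kc2|c2k] := leqP k c2; last first.
    apply: (leq_trans (card_setI_upto_lt d0A _)); first by rewrite d0E.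
    rewrite -(@card_uptoD1 d0) ?d0E // subset_leq_card //; apply/subsetP => i.
    rewrite !inE -!val_eqE /=; lia.
  (* The delicate tail: [upto c2 :\ d0] has exactly [r] elements, so an [r]-set inside [upto c2]
     that avoids [d0] is [botS] itself. *)
  have {c3k kc2} -> : k = c2 by lia.
  have lt_r : (#|A :&: upto c2| < r)%N.
    rewrite ltn_neqAle -{2}cA subset_leq_card ?subsetIl // andbT.
    apply: contra AS => /eqP cA2; have sA : A \subset upto c2.
      by apply/setIidPl/eqP; rewrite eqEcard subsetIl cA2 cA leqnn.
    rewrite eqEcard card_botS cA leqnn andbT; apply/subsetP => i iA.
    rewrite !inE; have := subsetP sA i iA; rewrite inE => ->.
    by rewrite andbT; apply: contraNneq d0A => <-.
  have <- : upto c1 :\ d0 = botS1 :&: upto c2.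
    by apply/setP => i; rewrite !inE -!val_eqE /=; lia.
  have h : (c1 <= d0)%N by lia.
  by rewrite card_uptoD1 //; lia.
apply: (leq_trans (card_setI_upto A k)).
rewrite -card_upto subset_leq_card //; apply/subsetP => i.
rewrite !inE -!val_eqE /=; lia.
Qed.

(** An [r]-set dominating a missing one is missing. Hence any missing non-star forces [botS]. A
    second one [B] forces [botS2] if it omits a vertex above [b]; otherwise it omits [d0] and forces
    [botS1]. As at most two are missing, [B] equals the set it forces. *)
Lemma missing_non_stars (E F : {set {set 'I_n}}) : left_compressed r E ->
  F = [set A : {set 'I_n} | (#|A| == r) && (A \notin E)] ->
  (#|[set A in F | ~~ (upto b \subset A)]| <= 2)%N ->
  [set A in F | ~~ (upto b \subset A)] != set0 ->
  exists2 P : {set {set 'I_n}}, [set A in F | ~~ (upto b \subset A)] = botS |: P &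
    [/\ botS \notin P, (#|P| <= 1)%N & {subset P <= [:: botS1; botS2]}].
Proof.
move=> lcE FE; set G := [set A in F | _] => G2 G0.
have inF A : (A \in F) = (#|A| == r) && (A \notin E) by rewrite FE inE.
have inG A : A \in G = [&& #|A| == r, A \notin E & ~~ (upto b \subset A)].
  by rewrite inE inF andbA.
have T0 : ~~ (upto b \subset botS).
  by apply/subsetPn; exists d0; rewrite !inE ?eqxx ?d0E.
have T1 : ~~ (upto b \subset botS1).
  by apply/subsetPn; exists d0; rewrite !inE ?eqxx ?d0E // andbF.
have T2 : ~~ (upto b \subset botS2).
  by apply/subsetPn; exists d1; rewrite !inE ?eqxx ?d1E //; lia.
have [A AG] := set0Pn _ G0.
have SG : botS \in G.
  rewrite inG card_botS T0 eqxx andbT /=; move: AG; rewrite inG => /and3P[/eqP cA AE nA].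
  apply: contra AE; apply: (left_compressed_dominated lcE cA card_botS) => k.
  exact: dominated_botS.
have S1N : botS1 != botS.
  apply/eqP => /setP/(_ c2); rewrite !inE eqxx /= leqnn -val_eqE /=; lia.
have S2N : botS2 != botS.
  apply/eqP => /setP/(_ d0); rewrite !inE eqxx /= -val_eqE /=; lia.
exists (G :\ botS); first by rewrite setD1K.
have cG : (#|G :\ botS| <= 1)%N by move: G2; rewrite (cardsD1 botS G) SG add1n ltnS.
split=> //; first by rewrite !inE eqxx.
move=> B BP.
have uP C : C \in G :\ botS -> B = C.
  by move=> CP; move: cG => /card_le1_eqP; apply.
have := BP; rewrite in_setD1 inG => /andP[BS /and3P[/eqP cB BE nB]].
have [UB|UB] := boolP (upto b.+1 \subset B); last first.
  suff /uP -> : botS2 \in G :\ botS by rewrite !inE eqxx orbT.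
  rewrite in_setD1 S2N inG card_botS2 eqxx T2 andbT /=.
  apply: contra BE; apply: (left_compressed_dominated lcE cB card_botS2) => k.
  exact: dominated_botS2.
have d0B : d0 \notin B.
  apply: contra nB => d0B; apply/subsetP => i; rewrite inE leq_eqVlt => /orP[/eqP bi|bi].
    by have -> : i = d0 by apply: val_inj; rewrite /= d0E.
  by apply: (subsetP UB); rewrite inE.
suff /uP -> : botS1 \in G :\ botS by rewrite !inE eqxx.
rewrite in_setD1 S1N inG card_botS1 eqxx T1 andbT /=.
apply: contra BE; apply: (left_compressed_dominated lcE cB card_botS1) => k.
exact: dominated_botS1.
Qed.

End NonStar.

(** * The stars as the last sets in the colex order *)

Lemma colex_graph_down n r m (A B : {set 'I_n}) : #|B| = r -> colex_lt B A ->
  A \in colex_graph n r m -> B \in colex_graph n r m.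
Proof.
move=> cB BA; rewrite !inE cB eqxx /= => /andP[_]; apply: leq_ltn_trans.
apply/subset_leq_card/subsetP => D; rewrite !inE => /andP[-> DB] /=.
exact: colex_lt_trans DB BA.
Qed.

Lemma colex_lt_star n b (i j : 'I_n) : (i < j)%N -> (j < b)%N ->
  colex_lt (i |: upto b) (j |: upto b).
Proof.
move=> ij jb; apply/colex_ltP; exists j; split.
- by rewrite !inE eqxx.
- by rewrite !inE -val_eqE /= negb_or -ltnNge jb andbT neq_ltn ij orbT.
- by move=> k jk; rewrite !inE -!val_eqE /= !gtn_eqF // (ltn_trans ij).
Qed.

(** The largest vertex of [upto b] outside [A] decides: the star contains it, and both sets contain
    everything above it. *)
Lemma colex_lt_non_star n b (A : {set 'I_n}) (j : 'I_n) : ~~ (upto b \subset A) ->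
  colex_lt A (j |: upto b).
Proof.
case/subsetPn => e0 e0T e0A.
have e0P : e0 \in upto b :\: A by rewrite inE e0T e0A.
case: (@arg_maxnP _ e0 (fun e => e \in upto b :\: A) (@nat_of_ord n) e0P) => e.
rewrite inE => /andP[eA eT] emax; apply/colex_ltP; exists e; split=> //.
  by rewrite inE eT orbT.
move=> k ek; have kT : k \in upto b.
  by move: eT; rewrite !inE => /leq_trans; apply; exact: ltnW.
rewrite in_setU kT orbT; apply: contraTT ek => kA; rewrite -leqNgt.
by apply: emax; rewrite inE kA.
Qed.

Lemma card_star n b r (i : 'I_n) : n.+1 = (b + r)%N -> (0 < r)%N -> (i < b)%N ->
  #|i |: upto b| = r.
Proof. by move=> nbr r0 ib; rewrite cardsU1 inE -ltnNge ib card_upto; lia. Qed.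

Lemma star_inj n b (i j : 'I_n) : (i < b)%N -> i |: upto b = j |: upto b -> i = j.
Proof.
move=> ib /setP/(_ i); rewrite !inE eqxx /= => /esym/orP[/eqP //|].
by rewrite leqNgt ib.
Qed.

Lemma card_colex_compl n r a : (0 < 'C(n, r) - a)%N ->
  #|[set A : {set 'I_n} | (#|A| == r) && (A \notin colex_graph n r ('C(n, r) - a))]| = a.
Proof.
set m := ('C(n, r) - a)%N => m0.
have cC := card_colex_graph (leq_subr a 'C(n, r)); rewrite -/m in cC.
have := cardsID (colex_graph n r m) [set A : {set 'I_n} | #|A| == r].
rewrite card_draws card_ord.
have -> : [set A : {set 'I_n} | #|A| == r] :&: colex_graph n r m = colex_graph n r m.
  by apply/setIidPr/subsetP => A; rewrite !inE => /andP[].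
have -> : [set A : {set 'I_n} | #|A| == r] :\: colex_graph n r m =
  [set A : {set 'I_n} | (#|A| == r) && (A \notin colex_graph n r m)].
  by apply/setP => A; rewrite in_setD 2!in_set andbC.
(* Positivity of [m] excludes truncation in ['C(n, r) - a]. *)
by rewrite cC => e; apply/eqP; rewrite -(eqn_add2l m) e subnK // ltnW // -subn_gt0.
Qed.

(** All [b] stars come after a non-star, so a missing non-star would bring the number of missing
    sets to at least [b + 1 > a]. *)
Lemma colex_compl_star n b r a (A : {set 'I_n}) : n.+1 = (b + r)%N -> (0 < r)%N ->
  (a <= b)%N -> (b <= n)%N -> (0 < 'C(n, r) - a)%N -> #|A| = r ->
  A \notin colex_graph n r ('C(n, r) - a) -> upto b \subset A.
Proof.
move=> nbr r0 ab bn m0 cA AC; apply: contraT => nA.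
have := card_colex_compl m0; set D := [set _ | _] => cD.
pose J := [set i : 'I_n | (i < b)%N].
pose st := [set i |: upto b | i : 'I_n in J].
have cst : #|st| = b.
  rewrite card_in_imset => [|i j iJ _]; last by apply: star_inj; rewrite inE in iJ.
  have := cardsC J; rewrite card_ord.
  have -> : ~: J = upto b by apply/setP => i; rewrite !inE -leqNgt.
  by rewrite card_upto; lia.
have sD : A |: st \subset D.
  apply/subsetP => B; rewrite in_setU1 in_set => /predU1P[->|]; first by rewrite cA eqxx AC.
  case/imsetP => i; rewrite inE => ib ->; rewrite (card_star nbr) // eqxx /=.
  by apply: contra AC; apply: colex_graph_down => //; exact: colex_lt_non_star.
have := subset_leq_card sD; rewrite cD cardsU1 cst.
suff -> : A \notin st by rewrite add1n ltnNge ab.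
by apply: contra nA => /imsetP[i _ ->]; exact: subsetUr.
Qed.

(** * Lagrangian polynomials and stationarity *)

Definition weight (R : realType) n (x : 'rV[R]_n) (A : {set 'I_n}) : R :=
  \prod_(i in A) x 0 i.

Definition off2 n (u v : 'I_n) : {pred {set 'I_n}} :=
  [pred B : {set 'I_n} | (u \notin B) && (v \notin B)].

(* A Lagrangian polynomial is affine in each of [x u] and [x v]: [link] is the
   coefficient of [x u], [link2] that of [x u * x v]. *)
Definition link (R : realType) n (E : {set {set 'I_n}}) (u v : 'I_n) (x : 'rV[R]_n) : R :=
  \sum_(B in off2 u v) (u |: B \in E)%:R * weight x B.

Definition link2 (R : realType) n (E : {set {set 'I_n}}) (u v : 'I_n) (x : 'rV[R]_n) : R :=
  \sum_(B in off2 u v) (u |: (v |: B) \in E)%:R * weight x B.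

Lemma big_setU1_split (V : nmodType) (T : finType) (u : T) (f : {set T} -> V) :
  \sum_A f A = \sum_(B : {set T} | u \notin B) (f B + f (u |: B)).
Proof.
rewrite (bigID (fun A : {set T} => u \notin A)) /= big_split /=; congr (_ + _).
rewrite (reindex_onto (fun B => u |: B) (fun A => A :\ u)) /=; last first.
  by move=> A; rewrite negbK => /setD1K.
apply: eq_bigl => B; rewrite negbK setU11 /=.
apply/eqP/idP => [<-|uB]; first by rewrite !inE eqxx.
exact: setU1K.
Qed.

Lemma big_setU2_split (V : nmodType) n (u v : 'I_n) (f : {set 'I_n} -> V) : u != v ->
  \sum_A f A = \sum_(B in off2 u v) (f B + f (v |: B) + (f (u |: B) + f (u |: (v |: B)))).
Proof.
move=> uv; rewrite (big_setU1_split u) big_mkcond (big_setU1_split v) /=.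
rewrite [RHS]big_mkcond [LHS]big_mkcond; apply: eq_bigr => B _.
rewrite !inE negb_or uv /=.
by case: (u \in B); case: (v \in B) => //=; rewrite ?addr0 // addrACA.
Qed.

Lemma weightU1 (R : realType) n (x : 'rV[R]_n) (v : 'I_n) (B : {set 'I_n}) : v \notin B ->
  weight x (v |: B) = x 0 v * weight x B.
Proof. by move=> vB; rewrite /weight big_setU1. Qed.

Lemma weight_ge0 (R : realType) n (x : 'rV[R]_n) (B : {set 'I_n}) :
  (forall i, 0 <= x 0 i) -> 0 <= weight x B.
Proof. by move=> x0; apply: prodr_ge0. Qed.

Lemma weight_gt0 (R : realType) n (x : 'rV[R]_n) (B : {set 'I_n}) :
  (forall i, 0 < x 0 i) -> 0 < weight x B.
Proof. by move=> x0; apply: prodr_gt0. Qed.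

Lemma lagr_polyE (R : realType) n (E : {set {set 'I_n}}) (x : 'rV[R]_n) :
  lagr_poly E x = \sum_A (A \in E)%:R * weight x A.
Proof.
rewrite /lagr_poly big_mkcond; apply: eq_bigr => A _.
by case: ifP => _; rewrite ?mul1r ?mul0r.
Qed.

Lemma lagr_poly_split (R : realType) n (E : {set {set 'I_n}}) (u v : 'I_n) (x : 'rV[R]_n) :
  u != v ->
  lagr_poly E x = \sum_(B in off2 u v) (B \in E)%:R * weight x B
    + x 0 u * link E u v x + x 0 v * link E v u x + x 0 u * x 0 v * link2 E u v x.
Proof.
move=> uv; rewrite lagr_polyE (big_setU2_split _ uv) /link /link2.
have -> : \sum_(B in off2 v u) (v |: B \in E)%:R * weight x B =
          \sum_(B in off2 u v) (v |: B \in E)%:R * weight x B.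
  by apply: eq_bigl => B; rewrite !inE andbC.
rewrite !mulr_sumr -!big_split /=; apply: eq_bigr => B; rewrite inE => /andP[uB vB].
rewrite !weightU1 ?inE ?negb_or ?uv //; ring.
Qed.

Lemma eq_weight (R : realType) n (x y : 'rV[R]_n) (B : {set 'I_n}) :
  (forall i, i \in B -> x 0 i = y 0 i) -> weight x B = weight y B.
Proof. by move=> e; apply: eq_bigr => i /e. Qed.

(** A first-order condition without derivatives: for [e] nonzero with the sign of [g], the bound
    gives [|g| <= |e| q], which contradicts [2 |e| (q + 1) <= |g|]. *)
Lemma eq0_of_local_bound (R : realType) (g q eta : R) : 0 < eta -> 0 <= q ->
  (forall e, `|e| <= eta -> e * g <= e ^+ 2 * q) -> g = 0.
Proof.
move=> eta0 q0 h; apply/eqP; rewrite -normr_eq0; apply/negPn/negP => g0.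
have {}g0 : 0 < `|g| by rewrite lt_def g0 normr_ge0.
pose e := Num.min eta (`|g| / (2 * (q + 1))).
have e0 : 0 < e by rewrite lt_min eta0 divr_gt0 // mulr_gt0 // ltr_wpDl.
have eg : e * (2 * (q + 1)) <= `|g|.
  by rewrite -ler_pdivlMr ?mulr_gt0 ?ltr_wpDl // ge_min lexx orbT.
have ee : e <= eta by rewrite ge_min lexx.
have : e * `|g| <= e ^+ 2 * q.
  case: (lerP 0 g) => [gp|gn].
    by have := h e; rewrite (ger0_norm (ltW e0)) ee => /(_ isT); rewrite ?ger0_norm.
  have := h (- e); rewrite normrN (ger0_norm (ltW e0)) ee => /(_ isT).
  by rewrite sqrrN mulNr -mulrN (ltr0_norm gn).
rewrite expr2 -mulrA ler_pM2l // => ge; nra.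
Qed.

(** Moving weight [e] from [v] to [u] changes the polynomial by [e * g - e ^+ 2 * link2 E u v x],
    where [g] is the right side minus the left side of the claim. Both weights are positive, so
    small [e] of either sign is allowed. *)
Lemma lagrangian_stationary (R : realType) n (E : {set {set 'I_n}}) (x : 'rV[R]_n)
    (u v : 'I_n) :
  simplex x -> (forall y, simplex y -> lagr_poly E y <= lagr_poly E x) ->
  u != v -> 0 < x 0 u -> 0 < x 0 v ->
  link2 E u v x * (x 0 u - x 0 v) = link E u v x - link E v u x.
Proof.
move=> [x0 x1] xmax uv xu xv; apply/eqP; rewrite eq_sym -subr_eq0; apply/eqP.
apply: (@eq0_of_local_bound _ _ (link2 E u v x) (Num.min (x 0 u) (x 0 v))).
- by rewrite lt_min xu.
- by apply: sumr_ge0 => B _; rewrite mulr_ge0 ?ler0n ?weight_ge0.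
move=> e; rewrite le_min => /andP[eu ev].
pose y : 'rV[R]_n := \row_j (x 0 j + e * (j == u)%:R - e * (j == v)%:R).
have yu : y 0 u = x 0 u + e by rewrite mxE eqxx (negPf uv) mulr1 mulr0 subr0.
have yv : y 0 v = x 0 v - e by rewrite mxE eqxx eq_sym (negPf uv) mulr1 mulr0 addr0.
have yj j : j != u -> j != v -> y 0 j = x 0 j.
  by move=> /negPf ju /negPf jv; rewrite mxE ju jv !mulr0 subr0 addr0.
have sy : simplex y.
  split=> [j|].
    have [->|ju] := eqVneq j u; first by rewrite yu; move: eu; rewrite ler_norml => /andP[? _]; lra.
    have [->|jv] := eqVneq j v; first by rewrite yv; move: ev; rewrite ler_norml => /andP[_ ?]; lra.
    by rewrite yj.
  under eq_bigr do rewrite mxE.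
  have d (k : 'I_n) : \sum_(j < n) e * (j == k)%:R = e.
    rewrite (bigD1 k) //= eqxx mulr1 big1 ?addr0 // => j /negPf ->; exact: mulr0.
  by rewrite !big_split /= sumrN !d x1 addrK.
have wB B : B \in off2 u v -> weight y B = weight x B.
  rewrite inE => /andP[uB vB]; apply: eq_weight => i iB; apply: yj.
    by apply: contraNneq uB => <-.
  by apply: contraNneq vB => <-.
have := xmax y sy; rewrite !(lagr_poly_split E _ uv) yu yv.
have -> : \sum_(B in off2 u v) (B \in E)%:R * weight y B =
    \sum_(B in off2 u v) (B \in E)%:R * weight x B.
  by apply: eq_bigr => B /wB ->.
have -> : link E u v y = link E u v x by apply: eq_bigr => B /wB ->.
have -> : link2 E u v y = link2 E u v x by apply: eq_bigr => B /wB ->.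
have -> : link E v u y = link E v u x.
  by apply: eq_bigr => B; rewrite inE andbC => /wB ->.
set s := \sum_(B in _) _; set l := link E u v x; set l' := link E v u x.
move=> h; rewrite -subr_ge0 in h; rewrite -subr_ge0; apply: le_trans h _.
by rewrite le_eqVlt; apply/orP; left; apply/eqP; ring.
Qed.

(** * Consequences of stationarity: monotone weights and sums over sets through a vertex *)

Lemma subset_of_card (T : finType) (D : {set T}) r : (#|D| <= r)%N -> (r <= #|T|)%N ->
  exists2 A : {set T}, D \subset A & #|A| = r.
Proof.
elim: r => [|r IH]; first by rewrite leqn0 => /eqP ? _; exists D.
rewrite leq_eqVlt => /predU1P[<-|]; first by move=> _; exists D.
rewrite ltnS => /IH h rT; have [A DA cA] := h (ltnW rT).
have [x xA] : exists x, x \notin A.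
  apply/existsP; rewrite -negb_forall; apply: contraL rT => /forallP h'.
  by rewrite -leqNgt -cA subset_leq_card //; apply/subsetP.
by exists (x |: A); rewrite ?cardsU1 ?xA ?cA // (subset_trans DA) // subsetUr.
Qed.

(** The edge through [u] and [v] makes [link2] positive, and replacing [v] by [u] in edges shows
    that the right side of the stationarity identity is nonnegative. *)
Lemma stationary_monotone (R : realType) n r (E : {set {set 'I_n}}) (x : 'rV[R]_n)
    (u v : 'I_n) (B : {set 'I_n}) :
  is_rgraph r E -> left_compressed r E -> (forall i, 0 < x 0 i) -> (u < v)%N ->
  link2 E u v x * (x 0 u - x 0 v) = link E u v x - link E v u x ->
  B \in off2 u v -> u |: (v |: B) \in E -> x 0 v <= x 0 u.
Proof.
move=> hE lcE x0 uv foc BP BE.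
have x0' i : 0 <= x 0 i by exact: ltW.
have q0 : 0 < link2 E u v x.
  rewrite /link2 (bigD1 B) //= BE mul1r ltr_pwDl ?weight_gt0 //.
  by apply: sumr_ge0 => C _; rewrite mulr_ge0 ?ler0n ?weight_ge0.
rewrite -subr_ge0 -(pmulr_rge0 _ q0) foc subr_ge0 /link.
rewrite (eq_bigl (fun C => C \in off2 u v)); last by move=> C; rewrite !inE andbC.
apply: ler_sum => C; rewrite inE => /andP[uC vC].
rewrite ler_wpM2r ?weight_ge0 // ler_nat.
have [vE|//] := boolP (v |: C \in E).
by rewrite (left_compressed_swap lcE (hE _ vE) uv uC vC).
Qed.

(* If no r-set through [o] is missing, [vlink r o v x] is [x v] times [link2] at
   [o, v], see [stationary_vlink]. *)
Definition vlink (R : realType) n r (o v : 'I_n) (x : 'rV[R]_n) : R :=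
  \sum_(A : {set 'I_n} | [&& #|A| == r.-1, v \in A & o \notin A]) weight x A.

Lemma big_off2 (V : nmodType) n (o v : 'I_n) (P : pred {set 'I_n}) (f : {set 'I_n} -> V) :
  o != v -> \sum_(A : {set 'I_n} | [&& P A, v \in A & o \notin A]) f A =
  \sum_(B in off2 o v | P (v |: B)) f (v |: B).
Proof.
move=> ov; rewrite big_mkcond (big_setU2_split _ ov) [RHS]big_mkcondr.
apply: eq_bigr => B; rewrite inE => /andP[oB vB].
by rewrite !inE !eqxx (negPf oB) (negPf vB) !(negPf ov) /= !andbF !andbT !addr0 add0r.
Qed.

(** Every [r]-set through [o] is an edge. So [link2] runs over all [(r-2)]-sets avoiding [o] and
    [v], and in the difference of the two links only those [B] survive for which [v |: B] is
    missing; the factor [x 0 v] completes both sides. *)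
Lemma stationary_vlink (R : realType) n r (E F : {set {set 'I_n}}) (x : 'rV[R]_n)
    (o v : 'I_n) : (1 < r)%N -> is_rgraph r E ->
  F = [set A : {set 'I_n} | (#|A| == r) && (A \notin E)] ->
  (forall A, A \in F -> o \notin A) -> o != v ->
  link2 E o v x * (x 0 o - x 0 v) = link E o v x - link E v o x ->
  vlink r o v x * (x 0 o - x 0 v) = \sum_(A in F | v \in A) weight x A.
Proof.
move=> r1 hE FE oF ov foc.
have -> : vlink r o v x = x 0 v * link2 E o v x.
  rewrite /vlink (big_off2 (fun A => #|A| == r.-1) _ ov) /link2 mulr_sumr big_mkcondr /=.
  apply: eq_bigr => B; rewrite inE => /andP[oB vB].
  have ovB : o \notin v |: B by rewrite !inE negb_or ov.
  have -> : (o |: (v |: B) \in E) = (#|v |: B| == r.-1).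
    have c : #|o |: (v |: B)| = #|v |: B|.+1 by rewrite cardsU1 ovB.
    apply/idP/eqP => [/hE|c2]; first by rewrite c => <-.
    apply: contraT => nE; have : o |: (v |: B) \in F.
      by rewrite FE inE nE c c2 prednK ?eqxx // ltnW.
    by move/oF; rewrite !inE eqxx.
  by case: eqP => _; rewrite ?mul1r ?mul0r ?mulr0 // weightU1.
rewrite -mulrA foc.
rewrite (eq_bigl (fun A => [&& A \in F, v \in A & o \notin A])); last first.
  move=> A; case AF: (A \in F) => //=; by rewrite (oF _ AF) andbT.
rewrite (big_off2 (fun A => A \in F) _ ov) /link [RHS]big_mkcondr /=.
rewrite [X in _ - X](eq_bigl (fun C => C \in off2 o v)); last by move=> C; rewrite !inE andbC.
rewrite -sumrB mulr_sumr; apply: eq_bigr => B; rewrite inE => /andP[oB vB].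
rewrite weightU1 // FE inE.
have c : #|o |: B| = #|v |: B| by rewrite !cardsU1 oB vB.
have -> : (o |: B \in E) = (#|v |: B| == r).
  rewrite -c; apply/idP/eqP => [/hE //|c2].
  apply: contraT => nE; have : o |: B \in F by rewrite FE inE nE c2 eqxx.
  by move/oF; rewrite !inE eqxx.
have [vE|vE] := boolP (v |: B \in E); first by rewrite (hE _ vE) eqxx /= subrr mulr0.
by case: eqP => _ /=; rewrite !mul0r subr0 ?mul0r ?mul1r ?mulr0.
Qed.

(** Sets through both [u] and [v] count on both sides; in the others, exchanging [v] for [u] does
    not lower the weight. *)
Lemma vlink_mono (R : realType) n r (o u v : 'I_n) (x : 'rV[R]_n) :
  (forall i, 0 <= x 0 i) -> o != u -> o != v -> x 0 v <= x 0 u ->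
  vlink r o v x <= vlink r o u x.
Proof.
move=> x0 ou ov xvu; have [->//|uv] := eqVneq u v.
rewrite /vlink !(big_mkcond (fun A : {set 'I_n} => [&& _, _ & _])) !(big_setU2_split _ uv).
apply: ler_sum => B; rewrite inE => /andP[uB vB].
have vuB : v \notin u |: B by rewrite !inE negb_or eq_sym uv.
have uvB : u \notin v |: B by rewrite !inE negb_or uv.
rewrite !inE !eqxx (negPf uB) (negPf vB) (negPf ou) (negPf ov) (negPf uv) (eq_sym v) (negPf uv) /=.
rewrite !andbF !add0r lerD2r.
rewrite !cardsU1 uB vB.
by case: ifP => // _; rewrite !weightU1 // ler_wpM2r ?weight_ge0.
Qed.

Lemma ler_sum_le1 (R : realType) (T : finType) (P : {set T}) (g : T -> R) (c : R) :
  (#|P| <= 1)%N -> 0 <= c -> (forall A, A \in P -> g A <= c) -> \sum_(A in P) g A <= c.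
Proof.
move=> cP c0 gc; apply: (le_trans (ler_sum _ gc)).
by rewrite sumr_const; case: #|P| cP => [|[|]] // _; rewrite ?mulr0n ?mulr1n.
Qed.

(** * Comparison of the weights of missing sets *)

Section KeyInequality.

Variables (R : realType) (n b r : nat) (o c3 c2 c1 d0 d1 : 'I_n).
Hypothesis nbr : n.+1 = (b + r)%N.
Hypotheses (b_ge12 : (12 <= b)%N) (r_ge4 : (4 <= r)%N).
Hypotheses (oE : o = 0%N :> nat) (c3E : c3.+3 = b) (c2E : c2.+2 = b) (c1E : c1.+1 = b).
Hypotheses (d0E : d0 = b :> nat) (d1E : d1 = b.+1 :> nat).
Variables (x : 'rV[R]_n) (I : {set 'I_n}) (P F : {set {set 'I_n}}).
Hypothesis x_gt0 : forall i, 0 < x 0 i.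
Hypothesis x_mono : forall u v : 'I_n, (u < v)%N -> x 0 v <= x 0 u.

Local Notation botS := (botS c2 d0).
Local Notation botS1 := (botS1 c3 c2 d0).
Local Notation botS2 := (botS2 c2 d1).
Local Notation X := (weight x (upto b.+1)).

Let X_gt0 : 0 < X. Proof. exact: weight_gt0. Qed.
Let x_ge0 i : 0 <= x 0 i. Proof. exact: ltW. Qed.

Lemma botS2_mem : [/\ c1 \in botS2, c2 \in botS2 & d0 \in botS2].
Proof. by split; rewrite !inE -!val_eqE /=; lia. Qed.

Lemma weight_star (i : 'I_n) : (i < b)%N -> weight x (i |: upto b) = x 0 i * x 0 d0 * X.
Proof.
move=> ib; have -> : upto b = d0 |: upto b.+1.
  by apply/setP => j; rewrite !inE -val_eqE /=; lia.
have h0 : d0 \notin upto b.+1 by rewrite inE; lia.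
have hi : i \notin d0 |: upto b.+1 by rewrite !inE -val_eqE /=; lia.
by rewrite !weightU1 // mulrA.
Qed.

Lemma weight_botS : weight x botS = x 0 c2 * x 0 c1 * X.
Proof.
have -> : botS = c2 |: (c1 |: upto b.+1).
  by apply/setP => j; rewrite !inE -!val_eqE /=; lia.
have h1 : c1 \notin upto b.+1 by rewrite inE; lia.
have h2 : c2 \notin c1 |: upto b.+1 by rewrite !inE -val_eqE /=; lia.
by rewrite !weightU1 // mulrA.
Qed.

Lemma weight_botS1 : weight x botS1 = x 0 c3 * x 0 c1 * X.
Proof.
have -> : botS1 = c3 |: (c1 |: upto b.+1).
  by apply/setP => j; rewrite !inE -!val_eqE /=; lia.
have h1 : c1 \notin upto b.+1 by rewrite inE; lia.
have h2 : c3 \notin c1 |: upto b.+1 by rewrite !inE -val_eqE /=; lia.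
by rewrite !weightU1 // mulrA.
Qed.

(** The factor [x 0 d1] supplies the vertex of [upto b.+1] that [botS2] lacks, which avoids a
    division. *)
Lemma weight_botS2 : weight x botS2 * x 0 d1 = x 0 c2 * x 0 c1 * x 0 d0 * X.
Proof.
have hd : d1 \notin botS2 by rewrite !inE eqxx.
rewrite mulrC -weightU1 //.
have -> : d1 |: botS2 = c2 |: (c1 |: (d0 |: upto b.+1)).
  by apply/setP => j; rewrite !inE -!val_eqE /=; lia.
have h0 : d0 \notin upto b.+1 by rewrite inE; lia.
have h1 : c1 \notin d0 |: upto b.+1 by rewrite !inE -val_eqE /=; lia.
have h2 : c2 \notin c1 |: (d0 |: upto b.+1) by rewrite !inE -!val_eqE /=; lia.
by rewrite !weightU1 // !mulrA.
Qed.

Hypothesis I_lt : forall i, i \in I -> (i < b)%N.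
Hypothesis oI : o \notin I.
Hypothesis cardI : (10 <= #|I|)%N.
Hypothesis cardP : (#|P| <= 1)%N.
Hypothesis P_sub : {subset P <= [:: botS1; botS2]}.
Hypothesis Fsum : forall f : {set 'I_n} -> R, \sum_(A in F) f A =
  \sum_(i in I) f (i |: upto b) + (f botS + \sum_(A in P) f A).
Hypothesis vlinkE : forall v, o != v ->
  vlink r o v x * (x 0 o - x 0 v) = \sum_(A in F | v \in A) weight x A.

Let sI := \sum_(i in I) x 0 i.

Let o_max v : x 0 v <= x 0 o.
Proof.
have [->//|ov] := eqVneq v o; apply: x_mono; rewrite oE lt0n.
by apply: contraNneq ov => v0; rewrite -val_eqE /= v0 oE.
Qed.

(** The coefficient vanishes at [c1] and [c2] and is 1 elsewhere. At least eight of the ten indices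
    remain, all at most [c3]. *)
Lemma sum_far_stars : 8 * x 0 c3 <=
  \sum_(i in I) (1 - (c1 == i)%:R - (c2 == i)%:R) * x 0 i.
Proof.
have c12 : c1 != c2 by rewrite -val_eqE /=; lia.
rewrite (bigID (fun i => i \in I :\ c1 :\ c2)) /= [X in _ + X]big1 ?addr0; last first.
  move=> i /andP[iI]; rewrite !inE iI andbT negb_and !negbK orbC => /orP[] /eqP ->.
    by rewrite eqxx eq_sym (negPf c12) subrr subr0 mul0r.
  by rewrite eqxx (negPf c12) subr0 subrr mul0r.
apply: (@le_trans _ _ (\sum_(i in I :\ c1 :\ c2) x 0 c3)).
  rewrite sumr_const -[leRHS]mulr_natl ler_wpM2r // ler_nat.
  have h (J : {set 'I_n}) c : (#|J| <= #|J :\ c|.+1)%N.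
    by rewrite (cardsD1 c J); case: (c \in J); rewrite ?leqnSn.
  have := leq_trans cardI (leq_trans (h I c1) (h (I :\ c1) c2 : (_.+1 <= _.+1)%N)).
  by rewrite !ltnS.
rewrite [leRHS](eq_bigl (fun i => i \in I :\ c1 :\ c2)); last first.
  by move=> i; rewrite !inE; case: (i \in I); rewrite ?andbF.
apply: ler_sum => i; rewrite !inE => /and3P[i2 i1 iI].
rewrite ![_ == i]eq_sym (negPf i1) (negPf i2) !subr0 mul1r.
have [->//|ic] := eqVneq i c3; apply: x_mono.
have := I_lt iI; move: i1 i2 ic; rewrite -!val_eqE /=; lia.
Qed.

Lemma sum_stars_ge : 8 * x 0 c3 <= sI.
Proof.
apply: (le_trans sum_far_stars); apply: ler_sum => i _.
by rewrite -[leRHS]mul1r ler_wpM2r.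
Qed.

Lemma sum_star_weights (f : 'I_n -> R) :
  \sum_(i in I) f i * weight x (i |: upto b) = (\sum_(i in I) f i * x 0 i) * x 0 d0 * X.
Proof.
rewrite !mulr_suml; apply: eq_bigr => i /I_lt ib; rewrite weight_star //; ring.
Qed.

(* For each [i] in [I], the sets [i |: upto b] with [d0], resp. the last vertex,
   removed both count in [vlink r o d1 x]. *)
Lemma vlink_d1_ge : 2 * sI * X <= vlink r o d1 x.
Proof.
have n_gt0 : (n.-1 < n)%N by lia.
(* As [r >= 4], the last vertex lies above [d1], so [d1] survives its removal. *)
pose l := Ordinal n_gt0.
pose f1 (i : 'I_n) := i |: upto b.+1.
pose f2 (i : 'I_n) := i |: (upto b :\ l).
have f1_inj : {in I &, injective f1}.
  move=> i j iI jI /setP/(_ i); rewrite !inE eqxx /= => /esym/orP[/eqP //|].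
  by have := I_lt iI; lia.
have f2_inj : {in I &, injective f2}.
  move=> i j iI jI /setP/(_ i); rewrite !inE eqxx /= => /esym/orP[/eqP //|].
  by have := I_lt iI; lia.
have w1 : \sum_(A in f1 @: I) weight x A = sI * X.
  rewrite big_imset //= mulr_suml; apply: eq_bigr => i /I_lt ib.
  by rewrite weightU1 // inE; lia.
(* Removing [l] leaves at least as much weight as removing [d0], since [x 0 l <= x 0 d0]. *)
have w2 : sI * X <= \sum_(A in f2 @: I) weight x A.
  rewrite big_imset //= mulr_suml; apply: ler_sum => i /I_lt ib.
  have ll : l \notin upto b :\ l by rewrite !inE eqxx.
  have il : i \notin upto b :\ l by rewrite !inE; lia.
  rewrite weightU1 // ler_pM2l // -(ler_pM2l (x_gt0 l)) -(weightU1 _ ll).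
  have -> : l |: (upto b :\ l) = d0 |: upto b.+1.
    by apply/setP => j; rewrite !inE -!val_eqE /=; lia.
  rewrite weightU1 ?ler_pM2r //; last by rewrite inE; lia.
  by apply: x_mono; rewrite /=; lia.
have cT : #|upto b :\ l| = r.-2.
  have h : (b <= l)%N by rewrite /=; lia.
  by rewrite (@card_uptoD1 n) //; lia.
have cU : #|@upto n b.+1| = r.-2 by rewrite card_upto; lia.
(* Membership of [d0] separates the two families: [f1] omits it, [f2] keeps it. *)
rewrite /vlink (bigID (fun A : {set 'I_n} => d0 \in A)) /= addrC.
have -> : 2 * sI * X = sI * X + sI * X by ring.
apply: lerD.
  rewrite -w1 [leRHS](bigID (fun A : {set 'I_n} => A \in f1 @: I)) /= -[leLHS]addr0 lerD //; last first.
    by apply: sumr_ge0 => A _; exact: weight_ge0.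
  rewrite [leLHS](eq_bigl (fun A : {set 'I_n} => ([&& #|A| == r.-1, d1 \in A & o \notin A] && (d0 \notin A))
     && (A \in f1 @: I))) // => A.
  rewrite andbC; case: imsetP => // -[i iI ->]; have ib := I_lt iI.
  have hi : i \notin upto b.+1 by rewrite inE; lia.
  rewrite /= cardsU1 hi cU !inE -!val_eqE /=.
  have oi : (o : nat) != i by rewrite val_eqE; apply: contraNneq oI => ->.
  by move: oi; lia.
apply: (le_trans w2).
  rewrite [leRHS](bigID (fun A : {set 'I_n} => A \in f2 @: I)) /= -[leLHS]addr0 lerD //; last first.
    by apply: sumr_ge0 => A _; exact: weight_ge0.
  rewrite [leLHS](eq_bigl (fun A : {set 'I_n} => ([&& #|A| == r.-1, d1 \in A & o \notin A] && (d0 \in A))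
     && (A \in f2 @: I))) // => A.
  rewrite andbC; case: imsetP => // -[i iI ->]; have ib := I_lt iI.
  have hi : i \notin upto b :\ l by rewrite !inE; lia.
  rewrite /= cardsU1 hi cT !inE -!val_eqE /=.
  have oi : (o : nat) != i by rewrite val_eqE; apply: contraNneq oI => ->.
  by move: oi; lia.
Qed.

(** Stationarity at [d1] bounds [2 * sI * (x 0 o - x 0 d1)] by [sI * x 0 d0] plus two terms
    [x 0 c3 * x 0 c1]. Each of these is at most [sI * x 0 o / 8], so the total is at most
    [5/4 * sI * x 0 o]. *)
Lemma x_d1_ge : 3 * x 0 o <= 8 * x 0 d1.
Proof.
have od1 : o != d1 by rewrite -val_eqE /=; lia.
have bound : \sum_(A in F | d1 \in A) weight x A <=
    (sI * x 0 d0 + 2 * (x 0 c3 * x 0 c1)) * X.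
  rewrite big_mkcondr Fsum /=.
  have -> : \sum_(i in I) (if d1 \in i |: upto b then weight x (i |: upto b) else 0) =
      sI * x 0 d0 * X.
    rewrite !mulr_suml; apply: eq_bigr => i /I_lt ib.
    by rewrite in_setU1 [d1 \in _]inE d1E leqnSn orbT weight_star.
  have hS : (if d1 \in botS then weight x botS else 0) <= x 0 c3 * x 0 c1 * X.
    case: ifP => _; last by rewrite !mulr_ge0 // ltW.
    by rewrite weight_botS !ler_pM2r //; apply: x_mono; lia.
  have hP : \sum_(A in P) (if d1 \in A then weight x A else 0) <= x 0 c3 * x 0 c1 * X.
    apply: ler_sum_le1 => //; first by rewrite !mulr_ge0 // ltW.
    move=> A /P_sub; rewrite !inE => /orP[]/eqP ->.
      by case: ifP => _; rewrite ?weight_botS1 // !mulr_ge0 // ltW.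
    (* [botS2] omits [d1] and contributes nothing. *)
    by rewrite !inE eqxx /= !mulr_ge0 // ltW.
  apply: (le_trans (lerD (lexx _) (lerD hS hP))).
  rewrite le_eqVlt; apply/orP; left; apply/eqP; ring.
have d_ge0 : 0 <= x 0 o - x 0 d1 by rewrite subr_ge0.
have h1 : 2 * sI * X * (x 0 o - x 0 d1) <= (sI * x 0 d0 + 2 * (x 0 c3 * x 0 c1)) * X.
  by apply: le_trans bound; rewrite -vlinkE // ler_wpM2r // vlink_d1_ge.
have h2 : 2 * sI * (x 0 o - x 0 d1) <= sI * x 0 d0 + 2 * (x 0 c3 * x 0 c1).
  rewrite -(ler_pM2r X_gt0); apply: le_trans h1.
  rewrite le_eqVlt; apply/orP; left; apply/eqP; ring.
have sI8 := sum_stars_ge.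
have h3 : 8 * (x 0 c3 * x 0 c1) <= sI * x 0 o.
  rewrite mulrA; apply: (@le_trans _ _ (sI * x 0 c1)); first by rewrite ler_pM2r.
  by rewrite ler_wpM2l // sumr_ge0.
have sI_gt0 : 0 < sI by apply: lt_le_trans sI8; rewrite mulr_gt0.
have h4 : sI * x 0 d0 <= sI * x 0 o by rewrite ler_pM2l.
have : sI * (3 * x 0 o) <= sI * (8 * x 0 d1) by lra.
by rewrite ler_pM2l.
Qed.

(* Every star contains [d0] and at most one of [c1], [c2], so the stars on the left
   cancel and at least eight are left on the right; they outweigh the three
   remaining terms from [botS], [botS1], [botS2], each at most 8/3 of a star. *)
Lemma missing_weight_le :
  \sum_(A in F | c1 \in A) weight x A + \sum_(A in F | c2 \in A) weight x A <=
  \sum_(A in F | d0 \in A) weight x A.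
Proof.
rewrite -subr_le0 !big_mkcondr -big_split -sumrB /=.
have -> : \sum_(A in F) ((if c1 \in A then weight x A else 0) +
     (if c2 \in A then weight x A else 0) - (if d0 \in A then weight x A else 0)) =
  \sum_(A in F) ((c1 \in A)%:R + (c2 \in A)%:R - (d0 \in A)%:R) * weight x A.
  apply: eq_bigr => A _; case: (c1 \in A); case: (c2 \in A); case: (d0 \in A) => /=; ring.
rewrite Fsum.
set K := 8 * x 0 c3 * x 0 d0 * X.
have K_ge0 : 0 <= K by rewrite !mulr_ge0 // ltW.
have hI : \sum_(i in I) ((c1 \in i |: upto b)%:R + (c2 \in i |: upto b)%:R
     - (d0 \in i |: upto b)%:R) * weight x (i |: upto b) <= - K.
  have -> : \sum_(i in I) ((c1 \in i |: upto b)%:R + (c2 \in i |: upto b)%:R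
     - (d0 \in i |: upto b)%:R) * weight x (i |: upto b) =
    - \sum_(i in I) (1 - (c1 == i)%:R - (c2 == i)%:R) * weight x (i |: upto b).
    rewrite -sumrN; apply: eq_bigr => i _; rewrite !in_setU1 !in_set.
    have -> : (b <= c1)%N = false by lia.
    have -> : (b <= c2)%N = false by lia.
    rewrite d0E leqnn !orbF orbT /=; ring.
  rewrite sum_star_weights lerN2 /K !ler_pM2r //; exact: sum_far_stars.
have x8 := x_d1_ge.
have hc : 3 * x 0 c1 <= 8 * x 0 d1 by apply: le_trans x8; rewrite ler_pM2l.
have hd : x 0 d1 <= x 0 d0 by apply: x_mono; lia.
have hc23 : x 0 c2 <= x 0 c3 by apply: x_mono; lia.
have hc0 : 3 * x 0 c1 <= 8 * x 0 d0 by lra.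
have hS1 : 3 * (x 0 c3 * x 0 c1 * X) <= K.
  have -> : 3 * (x 0 c3 * x 0 c1 * X) = (3 * x 0 c1) * (x 0 c3 * X) by ring.
  have -> : K = (8 * x 0 d0) * (x 0 c3 * X) by rewrite /K; ring.
  by rewrite ler_wpM2r // mulr_ge0 // ltW.
have hS : 3 * weight x botS <= K.
  by apply: le_trans hS1; rewrite weight_botS ler_pM2l // !ler_pM2r.
have hS2 : 3 * weight x botS2 <= K.
  rewrite -(ler_pM2r (x_gt0 d1)) -mulrA weight_botS2.
  have -> : 3 * (x 0 c2 * x 0 c1 * x 0 d0 * X) = (3 * x 0 c1) * (x 0 c2 * x 0 d0 * X) by ring.
  apply: (@le_trans _ _ ((8 * x 0 d1) * (x 0 c2 * x 0 d0 * X))).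
    by rewrite ler_wpM2r // !mulr_ge0 // ltW.
  have -> : K * x 0 d1 = (8 * x 0 d1) * (x 0 c3 * x 0 d0 * X) by rewrite /K; ring.
  by rewrite ler_pM2l ?mulr_gt0 // !ler_pM2r.
(* The gain [K] from the stars is exactly enough: [botS] counts at most twice, for [2 K / 3], and a
   set in [P] at most once, for [K / 3]. *)
have hf : ((c1 \in botS)%:R + (c2 \in botS)%:R - (d0 \in botS)%:R) * weight x botS
    <= 2 * weight x botS.
  rewrite ler_wpM2r ?weight_ge0 // !inE eqxx /=.
  by case: (_ && _); case: (_ && _) => /=; lra.
have hP : \sum_(A in P) ((c1 \in A)%:R + (c2 \in A)%:R - (d0 \in A)%:R) * weight x A
    <= K / 3.
  apply: ler_sum_le1 => //; first by rewrite divr_ge0.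
  move=> A /P_sub; rewrite !inE => /orP[]/eqP ->; rewrite ler_pdivlMr //.
    rewrite -weight_botS1 in hS1; rewrite !inE !eqxx /= andbF.
    have w0 : 0 <= weight x botS1 by exact: weight_ge0.
    by case: (_ && _) => /=; lra.
  have [-> -> ->] := botS2_mem.
  by rewrite /=; lra.
by lra.
Qed.

(** Among [c1], [c2], [d0], the vertex [d0] has the smallest [vlink], so the comparison of missing
    weights passes to the gaps [x 0 o - x 0 v]. *)
Lemma key_inequality : x 0 o * x 0 d0 <= x 0 c1 * x 0 c2.
Proof.
have oc1 : o != c1 by rewrite -val_eqE /=; lia.
have oc2 : o != c2 by rewrite -val_eqE /=; lia.
have od0 : o != d0 by rewrite -val_eqE /=; lia.
have hx1 : x 0 d0 <= x 0 c1 by apply: x_mono; lia.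
have hx2 : x 0 d0 <= x 0 c2 by apply: x_mono; lia.
have k1 := vlink_mono r x_ge0 oc1 od0 hx1.
have k2 := vlink_mono r x_ge0 oc2 od0 hx2.
have k0 : 0 < vlink r o d0 x.
  rewrite /vlink (bigD1 (upto b)) /=; last first.
    by rewrite card_upto !inE d0E leqnn oE /=; lia.
  by rewrite ltr_pwDl ?weight_gt0 // sumr_ge0 // => A _; exact: weight_ge0.
have e1 : 0 <= x 0 o - x 0 c1 by rewrite subr_ge0.
have e2 : 0 <= x 0 o - x 0 c2 by rewrite subr_ge0.
have : vlink r o d0 x * (x 0 o - x 0 c1 + (x 0 o - x 0 c2)) <=
       vlink r o d0 x * (x 0 o - x 0 d0).
  rewrite [leRHS]vlinkE //; apply: le_trans missing_weight_le.
  by rewrite -!vlinkE // mulrDr lerD // ler_wpM2r.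
rewrite ler_pM2l // => h.
(* With [p], [q] the gaps at [c1], [c2]: [x 0 c1 * x 0 c2 = x 0 o * (x 0 o - p - q) + p * q], and
   [x 0 o - p - q >= x 0 d0]. *)
have := mulr_ge0 e1 e2; have x0 := x_ge0 o.
have : 0 <= x 0 o * (x 0 o - x 0 d0 - (x 0 o - x 0 c1 + (x 0 o - x 0 c2))).
  by rewrite mulr_ge0 // subr_ge0.
by lra.
Qed.

(** For [botS] this is the key inequality; [botS1] and [botS2] arise from [botS] by replacing [c2]
    by [c3], resp. [d1] by [d0], and are no lighter. *)
Lemma non_star_weight_ge A : A \in [:: botS; botS1; botS2] ->
  x 0 o * x 0 d0 * X <= weight x A.
Proof.
have hS : x 0 o * x 0 d0 * X <= weight x botS.
  by rewrite weight_botS ler_pM2r // [leRHS]mulrC; exact: key_inequality.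
have h23 : x 0 c2 <= x 0 c3 by apply: x_mono; lia.
have h01 : x 0 d1 <= x 0 d0 by apply: x_mono; lia.
rewrite !inE => /or3P[] /eqP -> //; apply: (le_trans hS).
  by rewrite weight_botS weight_botS1 !ler_pM2r.
rewrite -(ler_pM2r (x_gt0 d1)) weight_botS2 weight_botS.
rewrite -[leRHS]mulrA -[leLHS]mulrA ler_pM2l ?mulr_gt0 //.
by rewrite mulrC ler_pM2r.
Qed.

End KeyInequality.

(* If [x w = 0], exchange [w] with [l]: only edges avoiding [l] keep a weight. *)
Lemma lagr_poly_zero_coord (R : realType) n r (E C : {set {set 'I_n}}) (x : 'rV[R]_n)
    (w l : 'I_n) : is_rgraph r E -> simplex x -> x 0 w = 0 ->
  (forall A : {set 'I_n}, #|A| = r -> l \notin A -> A \in C) ->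
  exists2 y : 'rV[R]_n, simplex y & lagr_poly E x <= lagr_poly C y.
Proof.
move=> hE [x0 x1] xw hC; pose s := tperm w l.
pose y : 'rV[R]_n := \row_j x 0 (s j).
have y0 j : 0 <= y 0 j by rewrite mxE.
have s_inj : injective (fun A : {set 'I_n} => s @: A) by exact/imset_inj/perm_inj.
exists y.
  split=> //; rewrite -x1 (reindex_inj (@perm_inj _ s)).
  by apply: eq_bigr => j _; rewrite mxE tpermK.
have wE A : weight x A = weight y (s @: A).
  rewrite /weight big_imset /=; last by move=> ? ? _ _; exact: perm_inj.
  by apply: eq_bigr => j _; rewrite mxE tpermK.
have -> : lagr_poly E x = \sum_(B in [set s @: A | A : {set 'I_n} in E]) weight y B.
  rewrite big_imset /=; last by move=> ? ? _ _; exact: s_inj.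
  by apply: eq_bigr => A _; exact: wE.
rewrite /lagr_poly [leLHS]big_mkcond [leRHS]big_mkcond /=; apply: ler_sum => B _.
case: imsetP => [[A AE BE]|_]; last by case: ifP => _ //; exact: weight_ge0.
have [lB|lB] := boolP (l \in B).
  suff -> : weight y B = 0 by case: ifP => _ //; exact: weight_ge0.
  by rewrite /weight (bigD1 l) //= mxE tpermR xw mul0r.
rewrite (hC B) // BE card_imset; [exact: hE | exact: perm_inj].
Qed.

(** * Splitting a family into stars and non-stars, and the theorem *)

Lemma star_of_superset n b r (A : {set 'I_n}) : n.+1 = (b + r)%N -> (0 < r)%N ->
  #|A| = r -> upto b \subset A -> exists2 i : 'I_n, (i < b)%N & A = i |: upto b.
Proof.
move=> nbr r0 cA TA; have /cards1P[i iE] : #|A :\: upto b| == 1%N.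
  have := cardsID (upto b) A; rewrite (setIidPr TA) card_upto cA => e.
  by apply/eqP; move: e; set k := #|_|; lia.
have AE : A = i |: upto b by rewrite -iE setUC setDE setUIr setUCr setIT; apply/esym/setUidPr.
have : i \in A :\: upto b by rewrite iE inE.
by rewrite !inE -ltnNge => /andP[ib _]; exists i.
Qed.

Lemma star_decomposition n b r (F : {set {set 'I_n}}) : n.+1 = (b + r)%N -> (0 < r)%N ->
  (forall A, A \in F -> #|A| = r) ->
  F = [set i |: upto b | i in [set i : 'I_n | (i < b)%N && (i |: upto b \in F)]] :|:
      [set A in F | ~~ (upto b \subset A)].
Proof.
move=> nbr r0 cF; apply/setP => A; rewrite !inE; apply/idP/orP; last first.
  by case=> [/imsetP[i]|/andP[] //]; rewrite inE => /andP[_ iF] ->.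
move=> AF; rewrite AF /=; have [TA|] := boolP (upto b \subset A); last by right.
have [i ib AE] := star_of_superset nbr r0 (cF _ AF) TA.
by left; apply/imsetP; exists i; rewrite // inE ib -AE.
Qed.

Lemma sum_star_decomposition (V : nmodType) n b r (F : {set {set 'I_n}}) (f : {set 'I_n} -> V) :
  n.+1 = (b + r)%N -> (0 < r)%N -> (forall A, A \in F -> #|A| = r) ->
  \sum_(A in F) f A =
  \sum_(i in [set i : 'I_n | (i < b)%N && (i |: upto b \in F)]) f (i |: upto b) +
  \sum_(A in [set A in F | ~~ (upto b \subset A)]) f A.
Proof.
move=> nbr r0 cF; set I := [set i : 'I_n | _]; set G := [set A in F | _].
rewrite (eq_bigl [predU [set i |: upto b | i in I] & G]) => [|A]; last first.
  by rewrite {1}(star_decomposition nbr r0 cF) in_setU.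
rewrite bigU /=; last first.
  rewrite -setI_eq0 -subset0; apply/subsetP => A; rewrite in_setI => /andP[/imsetP[i _ ->]].
  by rewrite inE subsetUr andbF.
rewrite big_imset //= => i j iI _; apply: star_inj.
by move: iI; rewrite inE => /andP[].
Qed.

Theorem theorem1p6 (R : realType) (m t a r : nat)
    (hm0 : (0 < m)%N) (ht0 : (0 < t)%N) (hr : (4 <= r)%N)
    (hm : m = ('C(t, r) - a)%N)
    (ha12 : (12 <= a)%N) (ha : (a <= t - r + 1)%N)
    (E : {set {set 'I_t}})
    (hE : is_rgraph r E) (hlc : left_compressed r E) (hcard : #|E| = m)
    (hsd : (#|symdiff E (colex_graph t r m)| <= 4)%N) :
  lagrangian R E <= lagrangian R (colex_graph t r m).
Proof.
set C := colex_graph t r m in hsd *.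
have [b bE] : exists b, b = (t - r + 1)%N by exists (t - r + 1)%N.
rewrite -bE in ha.
(* The bounds [12 <= a <= b] exclude truncation in [t - r]. *)
have nbr : t.+1 = (b + r)%N by rewrite bE; lia.
have b12 : (12 <= b)%N by exact: leq_trans ha12 ha.
have bt : (b <= t)%N by lia.
have [r0 r1 rt] : [/\ (0 < r)%N, (1 < r)%N & (r <= t)%N] by split; lia.
have [c3t c2t c1t] : [/\ (b - 3 < t)%N, (b - 2 < t)%N & (b - 1 < t)%N] by split; lia.
have [d0t d1t lt bl] : [/\ (b < t)%N, (b.+1 < t)%N, (t.-1 < t)%N & (b <= t.-1)%N] by split; lia.
have [b3 b2 b1] : [/\ (b - 3).+3 = b, (b - 2).+2 = b & (b - 1).+1 = b] by split; lia.
have c3_gt0 : (0 < b - 3)%N by lia.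
pose o := Ordinal ht0; pose l := Ordinal lt.
pose c3 := Ordinal c3t; pose c2 := Ordinal c2t; pose c1 := Ordinal c1t.
pose d0 := Ordinal d0t; pose d1 := Ordinal d1t.
have [oE d0E d1E] : [/\ o = 0%N :> nat, d0 = b :> nat & d1 = b.+1 :> nat] by [].
have [c3E c2E c1E] : [/\ c3.+3 = b, c2.+2 = b & c1.+1 = b] by [].
have cC : #|C| = m by apply: card_colex_graph; rewrite hm leq_subr.
have rC (A : {set 'I_t}) : A \in C -> #|A| = r by rewrite inE => /andP[/eqP].
pose F : {set {set 'I_t}} := [set A : {set 'I_t} | (#|A| == r) && (A \notin E)].
have starC (A : {set 'I_t}) : #|A| = r -> A \notin C -> upto b \subset A.
  by rewrite /C hm; apply: colex_compl_star; rewrite -?hm.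
have cEC : #|E :\: C| = #|C :\: E|.
  by have := cardsID C E; have := cardsID E C; rewrite setIC hcard cC => <- /addnI.
(* [E] and [C] have equal size, so each difference is half of the symmetric difference. *)
have cCE : (#|C :\: E| <= 2)%N.
  move: hsd; rewrite /symdiff cardsU cEC.
  have -> : (E :\: C) :&: (C :\: E) = set0.
    by apply/setP => A; rewrite !inE; case: (_ \in C); case: (_ \in E); rewrite ?andbF.
  by rewrite cards0 subn0; lia.
have [CE0|CE0] := eqVneq (C :\: E) set0.
  suff -> : E = C by [].
  apply/eqP; rewrite eqEsubset -!setD_eq0 CE0 eqxx andbT.
  by rewrite -cards_eq0 cEC CE0 cards0.
have [A0] := set0Pn _ CE0; rewrite inE => /andP[A0E A0C].
have [H0 H0P] : exists H0, H0 \in E :\: C.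
  by apply/set0Pn; rewrite -card_gt0 cEC card_gt0.
have H0r : #|H0| = r by move: H0P; rewrite inE => /andP[_ /hE].
have [H0C H0E] : H0 \notin C /\ H0 \in E by move: H0P; rewrite inE => /andP[].
have [j jb H0j] := star_of_superset nbr r0 H0r (starC _ H0r H0C).
have inF (A : {set 'I_t}) : (A \in F) = (#|A| == r) && (A \notin E) by rewrite inE.
have rF (A : {set 'I_t}) : A \in F -> #|A| = r by rewrite inF => /andP[/eqP].
have star_card (i : 'I_t) : (i < b)%N -> #|i |: upto b| = r by exact: card_star.
have upF (i k : 'I_t) : (i < k)%N -> (k < b)%N -> i |: upto b \in F -> k |: upto b \in F.
  move=> ik kb; rewrite !inF !star_card // ?eqxx ?(ltn_trans ik) //=; apply: contra.
  by apply: (left_compressed_swap hlc (star_card k kb) ik); rewrite inE -ltnNge // (ltn_trans ik).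
have upC (i k : 'I_t) : (i < k)%N -> (k < b)%N -> i |: upto b \notin C -> k |: upto b \notin C.
  move=> ik kb; apply: contra; apply: colex_graph_down; last exact: colex_lt_star.
  by rewrite star_card // (ltn_trans ik).
(* Stars missing from [E], and likewise from [C], have upward closed index sets. Star [j] is in [E]
   but not in [C], so no star can be in [C] but not in [E], whichever side of [j] its index lies
   on. *)
have nsCE (A : {set 'I_t}) : A \in C :\: E -> ~~ (upto b \subset A).
  rewrite inE => /andP[AE AC]; apply/negP => TA; have cA := rC _ AC.
  have [i ib Ai] := star_of_superset nbr r0 cA TA.
  have AF : A \in F by rewrite inF cA eqxx AE.
  case: (ltngtP i j) => [ij|ji|/val_inj ij].
  - by have := upF i j ij jb; rewrite -Ai -H0j AF inF H0E andbF => /(_ isT).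
  - by have := upC j i ji ib; rewrite -Ai -H0j H0C AC => /(_ isT).
  - by move: AE; rewrite Ai ij -H0j H0E.
have oF : o |: upto b \notin F.
  apply/negP => h; suff : H0 \in F by rewrite inF H0E andbF.
  rewrite H0j; have [<- //|oj] := eqVneq o j; apply: (upF o) => //.
  by rewrite lt0n; apply: contraNneq oj => j0; apply/eqP/val_inj.
have GE : [set A in F | ~~ (upto b \subset A)] = C :\: E.
  apply/setP => A; rewrite in_set inF; apply/idP/idP.
    case/andP=> /andP[/eqP cA AE] nA; rewrite inE AE /=.
    by apply: contraR nA; exact: starC.
  by move=> ACE; rewrite (nsCE _ ACE) andbT; move: ACE; rewrite inE => /andP[-> /rC ->]; rewrite eqxx.
pose I := [set i : 'I_t | (i < b)%N && (i |: upto b \in F)].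
(* Of the [a >= 12] stars missing from [C], at most two are edges of [E]. *)
have cI : (10 <= #|I|)%N.
  pose Fc : {set {set 'I_t}} := [set A : {set 'I_t} | (#|A| == r) && (A \notin C)].
  have cFc : #|Fc| = a.
    by rewrite /Fc /C hm; apply: card_colex_compl; rewrite -hm.
  have : (#|Fc :\: (E :\: C)| <= #|I|)%N.
    apply: leq_trans (leq_imset_card (fun i : 'I_t => i |: upto b) I).
    apply/subset_leq_card/subsetP => A; rewrite !in_setD [A \in Fc]in_set => /andP[+ /andP[/eqP cA AC]].
    rewrite AC /= => AE; have [i ib Ai] := star_of_superset nbr r0 cA (starC _ cA AC).
    by apply/imsetP; exists i; rewrite // inE ib inF -Ai cA eqxx.
  apply: leq_trans; rewrite cardsD cFc.
  have h : (#|Fc :&: (E :\: C)| <= 2)%N.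
    by apply: leq_trans cCE; rewrite -cEC subset_leq_card ?subsetIr.
  exact: leq_trans (leq_sub2r 2 ha12) (leq_sub2l a h).
have [P GP [SP cP Psub]] : exists2 P : {set {set 'I_t}},
    [set A in F | ~~ (upto b \subset A)] = botS c2 d0 |: P &
    [/\ botS c2 d0 \notin P, (#|P| <= 1)%N & {subset P <= [:: botS1 c3 c2 d0; botS2 c2 d1]}].
  apply: (missing_non_stars nbr b12 hr c3E c2E c1E d0E d1E hlc (erefl F)).
    by rewrite GE.
  by rewrite GE.
have Gsub (A : {set 'I_t}) : A \in C :\: E -> A \in [:: botS c2 d0; botS1 c3 c2 d0; botS2 c2 d1].
  by rewrite -GE GP in_setU1 in_cons => /orP[->//|/Psub ->]; rewrite orbT.
have oA (A : {set 'I_t}) : A \in F -> o \notin A.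
  rewrite (star_decomposition nbr r0 rF) in_setU => /orP[/imsetP[i]|].
    rewrite inE => /andP[ib iF] ->; rewrite !inE negb_or -ltnNge (leq_trans _ b12) // andbT.
    by apply: contraNneq oF => ->.
  by rewrite GE => /Gsub; apply: (bot_notin nbr b12 hr c3E c2E c1E d0E d1E).
have [x sx [xE xmax]] := lagrangian_max R E ht0.
have [z sz [zE zmax]] := lagrangian_max R C ht0.
rewrite -xE -zE.
have [[w xw]|x_neq0] := pselect (exists w, x 0 w = 0).
  have [|y sy] := lagr_poly_zero_coord (C := C) (l := l) hE sx xw.
    (* Every set missing from [C] contains [upto b], hence [l]. *)
    move=> A cA lA; apply: contraNT lA => AC.
    by apply: (subsetP (starC _ cA AC)); rewrite inE.
  by move=> le_y; apply: (le_trans le_y); exact: zmax.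
have x_gt0 i : 0 < x 0 i.
  by rewrite lt_def sx.1 andbT; apply/eqP => xi; apply: x_neq0; exists i.
have foc u v : u != v ->
    link2 E u v x * (x 0 u - x 0 v) = link E u v x - link E v u x.
  by move=> uv; apply: lagrangian_stationary.
have o_edge (A : {set 'I_t}) : #|A| = r -> o \in A -> A \in E.
  by move=> cA; apply: contraTT => AE; apply: oA; rewrite inF cA eqxx.
have x_mono (u v : 'I_t) : (u < v)%N -> x 0 v <= x 0 u.
  move=> uv; have nuv : u != v by rewrite -val_eqE /= ltn_eqF.
  (* The edge needed for monotonicity: three vertices fit into an [r]-set, and every [r]-set through
     [o] is an edge. *)
  have [A DA cA] : exists2 A : {set 'I_t}, o |: (u |: [set v]) \subset A & #|A| = r.
    apply: subset_of_card; last by rewrite card_ord.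
    by apply: leq_trans hr; rewrite !cardsU1 cards1; do 2 case: (_ \notin _).
  have uA : u \in A by apply: (subsetP DA); rewrite !inE eqxx orbT.
  have vA : v \in A by apply: (subsetP DA); rewrite !inE eqxx !orbT.
  have oA' : o \in A by apply: (subsetP DA); rewrite !inE eqxx.
  apply: (stationary_monotone (B := A :\ u :\ v) hE hlc x_gt0 uv (foc _ _ nuv)).
    by rewrite !inE !eqxx /= andbF.
  rewrite setD1K; last by rewrite !inE eq_sym nuv.
  by rewrite setD1K //; exact: o_edge.
have vlinkE v : o != v ->
    vlink r o v x * (x 0 o - x 0 v) = \sum_(A in F | v \in A) weight x A.
  by move=> ov; apply: (stationary_vlink (E := E)) => //; exact: foc.
have Fsum (f : {set 'I_t} -> R) : \sum_(A in F) f A =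
    \sum_(i in I) f (i |: upto b) + (f (botS c2 d0) + \sum_(A in P) f A).
  by rewrite (sum_star_decomposition f nbr r0 rF) GP big_setU1.
have I_lt i : i \in I -> (i < b)%N by rewrite inE => /andP[].
have oI : o \notin I by rewrite inE (negPf oF) andbF.
(* The weight of the star at [o] is the threshold between edges of [C :\: E] and those of
   [E :\: C]. *)
pose K := x 0 o * x 0 d0 * weight x (upto b.+1).
have K_le (A : {set 'I_t}) : A \in C :\: E -> K <= weight x A.
  move/Gsub; exact: (non_star_weight_ge nbr b12 hr oE c3E c2E c1E d0E d1E
    x_gt0 x_mono I_lt oI cI cP Psub Fsum vlinkE).
have K_ge (A : {set 'I_t}) : A \in E :\: C -> weight x A <= K.
  rewrite inE => /andP[AC AE].
  have [i ib ->] := star_of_superset nbr r0 (hE _ AE) (starC _ (hE _ AE) AC).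
  rewrite (weight_star nbr b12 hr oE c3E c2E c1E d0E d1E) // /K -!mulrA ler_pM2r ?mulr_gt0 ?weight_gt0 //.
  have [->//|io] := eqVneq i o; apply: x_mono; rewrite lt0n.
  by apply: contraNneq io => i0; apply/eqP/val_inj.
(* It suffices to compare both polynomials at [x]: common edges cancel, and the two differences have
   equally many sets. *)
apply: le_trans (zmax x sx); rewrite /lagr_poly.
rewrite (big_setID C) [leRHS](big_setID E) /= setIC lerD2l.
apply: (le_trans (ler_sum _ K_ge)); apply: le_trans (ler_sum _ K_le).
by rewrite !sumr_const cEC.
Qed.
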